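(* Let $\Phi=(G,\varphi)$ be a connected $\mathbb{T}$-gain graph and $<$ a total order on $V(G)$. The following are equivalent: (i) $\Phi$ is balanced; (ii) $D^{\max}_{<}(\Phi)$ has the same spectrum as $D(G)$; (iii) $D^{\min}_{<}(\Phi)$ has the same spectrum as $D(G)$; (iv) the largest eigenvalues of $D^{\max}_{<}(\Phi)$ and $D(G)$ are equal; (v) the largest eigenvalues of $D^{\min}_{<}(\Phi)$ and $D(G)$ are equal.
   Context: $\mathbb{T}=\{z\in\mathbb{C}:|z|=1\}$. A $\mathbb{T}$-gain graph $\Phi=(G,\varphi)$ on a simple graph $G$ with vertices $v_1,\dots,v_n$ assigns to each oriented edge $\overrightarrow{e}_{i,j}$ an element $\varphi(\overrightarrow{e}_{i,j})\in\mathbb{T}$ with $\varphi(\overrightarrow{e}_{j,i})=\varphi(\overrightarrow{e}_{i,j})^{-1}$. The gain of an oriented path or cycle is the product of the gains of its consecutive oriented edges; $\Phi$ is balanced if every cycle has gain $1$. $d(s,t)$ is the graph distance and $D(G)=(d(v_i,v_j))$ the distance matrix. $\mathcal{P}(s,t)$ is the set of oriented shortest paths from $s$ to $t$; $\mathcal{P}^{\max}(s,t)$ (resp. $\mathcal{P}^{\min}(s,t)$) is the set of those whose gain has maximum (resp. minimum) real part in $\mathcal{P}(s,t)$. For $s<t$, $\varphi^{<}_{\max}(s,t)$ is the gain of a path in $\mathcal{P}^{\max}(s,t)$ with maximum imaginary part of gain among paths in $\mathcal{P}^{\max}(s,t)$, and $\varphi^{<}_{\max}(t,s)=\overline{\varphi^{<}_{\max}(s,t)}$;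 $\varphi^{<}_{\min}(s,t)$ is the gain of a path in $\mathcal{P}^{\min}(s,t)$ with minimum imaginary part of gain among paths in $\mathcal{P}^{\min}(s,t)$, and $\varphi^{<}_{\min}(t,s)=\overline{\varphi^{<}_{\min}(s,t)}$. $D^{\max}_{<}(\Phi)=(\varphi^{<}_{\max}(v_i,v_j)d(v_i,v_j))$ and $D^{\min}_{<}(\Phi)=(\varphi^{<}_{\min}(v_i,v_j)d(v_i,v_j))$ (Hermitian matrices). *)

(* Defs.v *)
From HB Require Import structures.
From mathcomp Require Import all_boot all_order all_algebra.
From mathcomp Require Import reals.
From mathcomp Require Export complex.

Set Implicit Arguments.
Unset Strict Implicit.
Unset Printing Implicit Defensive.

Import Order.TTheory GRing.Theory Num.Theory.
Local Open Scope ring_scope.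
Local Open Scope complex_scope.

Record sgraph (n : nat) := SGraph {
  adj :> rel 'I_n;
  adj_sym : symmetric adj;
  adj_irr : irreflexive adj }.

(* Only the values of [gain] on adjacent pairs are meaningful. *)
Record gain_graph (R : realType) (n : nat) := GainGraph {
  ugraph : sgraph n;
  gain : 'I_n -> 'I_n -> R[i];
  gain_norm : forall u v, ugraph u v -> `|gain u v| = 1;
  gain_inv : forall u v, ugraph u v -> gain v u = (gain u v)^-1 }.

Definition strict_total_order (T : eqType) (lt : rel T) : Prop :=
  [/\ irreflexive lt, transitive lt &
      forall s t, s != t -> lt s t || lt t s].

Section Distance.
Variables (n : nat) (G : sgraph n).

Definition connected : Prop := (0 < n)%N /\ forall u v, connect G u v.

(* The sequence of vertices s :: p is a path of G from s to t. *)
Definition is_path (s t : 'I_n) (p : seq 'I_n) : bool :=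
  [&& path G s p, last s p == t & uniq (s :: p)].

(* Least length of a path from s to t (a path has fewer than n edges);
   the value is n when there is none. *)
Definition dist (s t : 'I_n) : nat :=
  find (fun k => [exists p : k.-tuple 'I_n, is_path s t p]) (iota 0 n).

Definition shortest_paths (s t : 'I_n) : {set (dist s t).-tuple 'I_n} :=
  [set p : (dist s t).-tuple 'I_n | is_path s t p].

End Distance.

Section Gain.
Variables (R : realType) (n : nat) (Phi : gain_graph R n).
Local Notation G := (ugraph Phi).

Fixpoint path_gain (s : 'I_n) (p : seq 'I_n) : R[i] :=
  if p is u :: q then gain Phi s u * path_gain u q else 1.

Definition cycle_gain (c : seq 'I_n) : R[i] :=
  if c is s :: p then path_gain s (rcons p s) else 1.

Definition balanced : Prop :=
  forall c : seq 'I_n, (2 < size c)%N -> ucycle G c -> cycle_gain c = 1.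

Definition max_paths (s t : 'I_n) : {set (dist G s t).-tuple 'I_n} :=
  [set p in shortest_paths G s t |
    [forall q in shortest_paths G s t,
      complex.Re (path_gain s q) <= complex.Re (path_gain s p)]].

Definition min_paths (s t : 'I_n) : {set (dist G s t).-tuple 'I_n} :=
  [set p in shortest_paths G s t |
    [forall q in shortest_paths G s t,
      complex.Re (path_gain s p) <= complex.Re (path_gain s q)]].

(* All the paths that [pick] may select have the same gain; the value 0 is
   only used when t cannot be reached from s. *)
Definition opt_max (s t : 'I_n) : R[i] :=
  if [pick p in max_paths s t | [forall q in max_paths s t,
        complex.Im (path_gain s q) <= complex.Im (path_gain s p)]] is Some p
  then path_gain s p else 0.

Definition opt_min (s t : 'I_n) : R[i] :=
  if [pick p in min_paths s t | [forall q in min_paths s t,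
        complex.Im (path_gain s p) <= complex.Im (path_gain s q)]] is Some p
  then path_gain s p else 0.

Variable lt : rel 'I_n.

(* On the diagonal the value is irrelevant since dist s s = 0. *)
Definition gain_max (s t : 'I_n) : R[i] :=
  if lt t s then (opt_max t s)^* else opt_max s t.

Definition gain_min (s t : 'I_n) : R[i] :=
  if lt t s then (opt_min t s)^* else opt_min s t.

Definition Dmax : 'M[R[i]]_n :=
  \matrix_(s, t) (gain_max s t * (dist G s t)%:R).

Definition Dmin : 'M[R[i]]_n :=
  \matrix_(s, t) (gain_min s t * (dist G s t)%:R).

End Gain.

Definition distmx (R : realType) (n : nat) (G : sgraph n) : 'M[R[i]]_n :=
  \matrix_(s, t) (dist G s t)%:R.

Section Spectrum.
Variables (R : realType) (n : nat).
Implicit Types A B : 'M[R[i]]_n.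

(* The eigenvalues of A, listed with their algebraic multiplicities. *)
Definition spectrum A : seq R[i] :=
  sval (closed_field_poly_normal (char_poly A)).

Definition same_spectrum A B : Prop := perm_eq (spectrum A) (spectrum B).

(* In R[i], x <= y means that y - x is a nonnegative real number. *)
Definition largest_eigenvalue A (l : R) : Prop :=
  eigenvalue A l%:C /\ forall x : R[i], eigenvalue A x -> x <= l%:C.

Definition same_largest_eigenvalue A B : Prop :=
  exists l : R, largest_eigenvalue A l /\ largest_eigenvalue B l.

End Spectrum.

(* Main.v *)
(** A connected gain graph is balanced iff its gain is a coboundary,
    [gain u v = theta u / theta v]. In that case every path from s to t has
    gain [theta s / theta t], so both gain distance matrices are conjugate to
    the distance matrix D by the diagonal matrix of theta. Conversely, let A be
    a gain distance matrix having the largest eigenvalue l of D as an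
    eigenvalue, with eigenvector x. The entries of A have the entries of D as
    moduli, so |x| reaches the maximum l of the Rayleigh quotient of D and is
    an eigenvector of D; as D is positive off the diagonal, x has no zero
    entry. Equality in the triangle inequality then gives
    [A s t = D s t * (theta s / theta t)] with [theta s = |x s| / x s], and on
    adjacent vertices A is the gain. *)
Require Import Defs.
From HB Require Import structures.
From mathcomp Require Import all_boot all_order all_algebra.
From mathcomp Require Import reals ring.

Set Implicit Arguments.
Unset Strict Implicit.
Unset Printing Implicit Defensive.

Import Order.TTheory GRing.Theory Num.Theory.
Local Open Scope ring_scope.

Lemma uniq_size_ord n (s : seq 'I_n) : uniq s -> (size s <= n)%N.
Proof. by move/card_uniqP <-; rewrite -[leqRHS]card_ord max_card. Qed.

(** * Distances and reversal of walks *)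

Section DistanceTheory.
Variables (n : nat) (G : sgraph n).
Implicit Types (s t : 'I_n) (p : seq 'I_n).

Lemma adj_rev_path s p :
  path G s p -> path G (last s p) (rev (belast s p)).
Proof. by rewrite rev_path; apply: sub_path => u v; rewrite adj_sym. Qed.

Lemma last_rev_belast s p : last (last s p) (rev (belast s p)) = s.
Proof. by case: p => [//|u p] /=; rewrite rev_cons last_rcons. Qed.

Lemma dist_le_size s p : path G s p -> (dist G s (last s p) <= size p)%N.
Proof.
case/shortenP=> q Gq uq subq; have /= /andP[_ uq'] := uq.
apply: leq_trans (uniq_leq_size uq' subq).
have q_lt := uniq_size_ord uq.
(* A list without repetition has at most [n] vertices, so [size q] is a position of [iota 0 n], and
   [find] cannot stop beyond it. *)
rewrite leqNgt; apply/negP => /(before_find 0%N).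
rewrite nth_iota //= add0n => /existsP[].
by exists (in_tuple q); rewrite /is_path Gq uq eqxx.
Qed.

Lemma shortest_path_exists s t :
  connect G s t -> exists p : (dist G s t).-tuple 'I_n, is_path G s t p.
Proof.
case/connectP => p0 /shortenP[q Gq uq _] ->.
have q_lt := uniq_size_ord uq.
have hasP : has (fun k => [exists p : k.-tuple 'I_n, is_path G s (last s q) p])
    (iota 0 n).
  apply/hasP; exists (size q); first by rewrite mem_iota.
  by apply/existsP; exists (in_tuple q); rewrite /is_path Gq uq eqxx.
have := nth_find 0%N hasP; rewrite nth_iota ?add0n; first by move/existsP.
by rewrite has_find size_iota in hasP.
Qed.

Lemma dist_sym s t : connected G -> dist G s t = dist G t s.
Proof.
case=> _ Gc; suff le_dist u v : (dist G u v <= dist G v u)%N.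
  by apply/eqP; rewrite eqn_leq !le_dist.
have [p /and3P[Gp /eqP lp _]] := shortest_path_exists (Gc v u).
have := dist_le_size (adj_rev_path Gp).
by rewrite last_rev_belast size_rev size_belast lp size_tuple.
Qed.

Lemma distss s : dist G s s = 0%N.
Proof. by apply/eqP; rewrite -leqn0; exact: (@dist_le_size s [::]). Qed.

Lemma dist_gt0 s t : connected G -> s != t -> (0 < dist G s t)%N.
Proof.
case=> _ Gc; apply: contraNT; rewrite -leqNgt leqn0 => /eqP d0.
have [[p /= /eqP]] := shortest_path_exists (Gc s t).
by rewrite d0 => /size0nil -> /and3P[].
Qed.

Lemma dist_adj s t : connected G -> G s t -> dist G s t = 1%N.
Proof.
move=> Gc Gst; apply/eqP; rewrite eqn_leq dist_gt0 //.
  by rewrite (@dist_le_size s [:: t]) //= Gst.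
by apply: contraTneq Gst => ->; rewrite adj_irr.
Qed.

End DistanceTheory.

(** * Gains of walks, balance and potentials *)

Section GainTheory.
Variables (R : realType) (n : nat) (Phi : gain_graph R n).
Local Notation G := (ugraph Phi).
Implicit Types (s t u v : 'I_n) (p q : seq 'I_n).

Lemma path_gain_cat s p q :
  path_gain Phi s (p ++ q) = path_gain Phi s p * path_gain Phi (last s p) q.
Proof. by elim: p s => [|u p IHp] s /=; rewrite ?mul1r // IHp mulrA. Qed.

Lemma path_gain_norm s p : path G s p -> `|path_gain Phi s p| = 1.
Proof.
elim: p s => [|u p IHp] s /=; first by rewrite normr1.
by case/andP=> Gsu Gp; rewrite normrM gain_norm // IHp // mulr1.
Qed.

Lemma path_gain_neq0 s p : path G s p -> path_gain Phi s p != 0.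
Proof.
by move=> /path_gain_norm gp1; rewrite -normr_eq0 gp1 oner_neq0.
Qed.

Lemma path_gain_rev s p : path G s p ->
  path_gain Phi (last s p) (rev (belast s p)) = (path_gain Phi s p)^-1.
Proof.
elim: p s => [|u p IHp] s /=; first by rewrite invr1.
case/andP=> Gsu Gp; rewrite rev_cons -cats1 path_gain_cat IHp //.
by rewrite last_rev_belast /= mulr1 gain_inv // invfM mulrC.
Qed.

Lemma conjc_path_gain s p : path G s p ->
  conjc (path_gain Phi s p) = (path_gain Phi s p)^-1.
Proof.
by move=> /path_gain_norm gp1; rewrite invC_norm gp1 expr1n invr1 mul1r.
Qed.

(* A repeated vertex splits a closed walk into two shorter ones. *)
Lemma balanced_closed_walk s p :
  balanced Phi -> path G s p -> last s p = s -> path_gain Phi s p = 1.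
Proof.
move=> bal; have [m] := ubnP (size p); elim: m s p => // m IHm s p.
rewrite ltnS => sz_p Gp lp; have [up|] := boolP (uniq p); last first.
  case/(uniqPn s) => i [j [ltij ltj Ep]].
  pose x := nth s p i.
  have lt_i := ltn_trans ltij ltj.
  (* The middle segment is a closed walk at [x]. The induction hypothesis applies to it, then to the
     concatenation of the two outer segments. *)
  have Ep2 : p = rcons (take i p) x ++
                 (rcons (take (j - i.+1) (drop i.+1 p)) x ++ drop j.+1 p).
    rewrite -[LHS](cat_take_drop i.+1) (take_nth s) //; congr (_ ++ _).
    rewrite -[LHS](cat_take_drop (j - i.+1).+1) (take_nth s); last first.
      by rewrite size_drop ltn_sub2r // (leq_ltn_trans ltij).
    by rewrite nth_drop subnKC // -Ep drop_drop addSn addnC subnKC.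
  move: sz_p Gp lp {Ep}; rewrite {}Ep2.
  set a := take i p; set b := take _ _; set c := drop _ _.
  rewrite !size_cat !size_rcons !cat_path !last_cat !last_rcons.
  move=> sz_p /and3P[Ga Gb Gc] lc.
  rewrite !path_gain_cat !last_rcons (IHm x (rcons b x)) //; last 2 first.
  - by rewrite size_rcons; apply: leq_trans sz_p; rewrite addSn addnS !ltnS
      (leq_trans (leq_addr (size c) _)) // leq_addl.
  - by rewrite last_rcons.
  rewrite mul1r -[x in path_gain _ x c](last_rcons s a) -path_gain_cat IHm //.
  - apply: leq_trans sz_p; rewrite size_cat size_rcons ltn_add2l addSn ltnS.
    exact: leq_addl.
  - by rewrite cat_path Ga last_rcons.
  - by rewrite last_cat last_rcons.
case: (lastP p) Gp lp up sz_p => [//|q y]; rewrite last_rcons => Gp lp.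
rewrite {y}lp in Gp * => up _.
(* With at least three vertices, [s :: q] is a genuine cycle. Otherwise the walk would be a loop,
   excluded by irreflexivity, or it traverses one edge back and forth, and the two gains cancel. *)
have [] := boolP (2 < size (s :: q))%N => [sz_q|].
  apply: (bal (s :: q)) => //; rewrite /ucycle /ucycleb /= Gp.
  by move: up; rewrite rcons_uniq.
case: q Gp {up} => [|a [|b q]] //=; first by rewrite adj_irr.
case/and3P=> Gsa _ _ _; rewrite mulr1 (gain_inv Gsa) mulfV //.
by rewrite -normr_eq0 gain_norm ?oner_neq0.
Qed.

Lemma path_gain_potential (theta : 'I_n -> R[i]) :
    (forall v, theta v != 0) ->
    (forall u v, G u v -> gain Phi u v = theta u / theta v) ->
  forall s p, path G s p -> path_gain Phi s p = theta s / theta (last s p).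
Proof.
move=> th0 thE s p; elim: p s => [|u p IHp] s /=; first by rewrite divff.
by case/andP=> Gsu Gp; rewrite thE // IHp // mulrA divfK.
Qed.

Lemma potential_balanced (theta : 'I_n -> R[i]) :
    (forall v, theta v != 0) ->
    (forall u v, G u v -> gain Phi u v = theta u / theta v) ->
  balanced Phi.
Proof.
move=> th0 thE [|s p] // _ /andP[/= Gp _].
by rewrite (path_gain_potential th0 thE) // last_rcons divff.
Qed.

(** Take for [theta v] the gain of a chosen walk from [v] to a root [r]. The edge from [u] to [v],
    the walk from [v] and the reversed walk from [u] form a closed walk, whose gain is 1. *)
Lemma balanced_potential : connected G -> balanced Phi ->
  exists2 theta : 'I_n -> R[i], forall v, theta v != 0 &
    forall u v, G u v -> gain Phi u v = theta u / theta v.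
Proof.
move=> [n_gt0 Gc] bal; pose r := Ordinal n_gt0.
have walk v : {p | path G v p & last v p == r}.
  by apply: sig2W; have /connectP[p Gp ->] := Gc v r; exists p.
pose theta v := path_gain Phi v (s2val (walk v)).
have th0 v : theta v != 0 by apply/path_gain_neq0/(s2valP (walk v)).
exists theta => // u v Guv; rewrite /theta.
case: (walk v) => p Gp lp; case: (walk u) => q Gq lq /=.
have {}lp := eqP lp; have {}lq := eqP lq.
have Gc' : path G u (v :: p ++ rev (belast u q)).
  by rewrite /= Guv cat_path Gp lp -lq adj_rev_path.
have := balanced_closed_walk bal Gc'.
rewrite /= last_cat lp -{1}lq last_rev_belast path_gain_cat lp -lq.
rewrite path_gain_rev // mulrA => /(_ erefl) E.
have qN0 := path_gain_neq0 Gq; have pN0 := path_gain_neq0 Gp.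
apply: (mulIf pN0); rewrite divfK //.
by apply: (mulIf (invr_neq0 qN0)); rewrite E divff.
Qed.

(* Every entry of Dmax and Dmin is the distance times the gain of some
   shortest path; the argument uses no other property of the selection. *)
Definition geodesic_gain (g : 'I_n -> 'I_n -> R[i]) : Prop :=
  forall s t, exists2 p, [/\ path G s p, last s p = t & size p = dist G s t]
                       & g s t = path_gain Phi s p.

(** Connectedness makes the finite set of shortest paths nonempty. Maximizing the real part, then
    the imaginary part among the maximizers, shows that [pick] succeeds, so the default 0 is never
    returned. *)
Lemma opt_max_geodesic : connected G -> geodesic_gain (opt_max Phi).
Proof.
move=> [_ Gc] s t; have [p0 p0P] := shortest_path_exists (Gc s t).
have p0S : p0 \in shortest_paths G s t by rewrite inE.
pose reg (p : (dist G s t).-tuple 'I_n) := complex.Re (path_gain Phi s p).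
pose img (p : (dist G s t).-tuple 'I_n) := complex.Im (path_gain Phi s p).
have [p1 p1S p1M] := @arg_maxP _ _ _ p0 (mem (shortest_paths G s t)) reg p0S.
have p1X : p1 \in max_paths Phi s t.
  rewrite in_set; apply/andP; split=> //.
  by apply/'forall_implyP => q; apply: p1M.
have [p2 p2S p2M] := @arg_maxP _ _ _ p1 (mem (max_paths Phi s t)) img p1X.
rewrite /opt_max; case: pickP => [p|/(_ p2)/negbT/negP[]]; last first.
  by apply/andP; split=> //; apply/'forall_implyP => q; apply: p2M.
case/andP; rewrite !inE => /andP[/and3P[Gp /eqP lp _] _] _.
by exists p; rewrite ?size_tuple.
Qed.

Lemma opt_min_geodesic : connected G -> geodesic_gain (opt_min Phi).
Proof.
move=> [_ Gc] s t; have [p0 p0P] := shortest_path_exists (Gc s t).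
have p0S : p0 \in shortest_paths G s t by rewrite inE.
pose reg (p : (dist G s t).-tuple 'I_n) := complex.Re (path_gain Phi s p).
pose img (p : (dist G s t).-tuple 'I_n) := complex.Im (path_gain Phi s p).
have [p1 p1S p1M] := @arg_minP _ _ _ p0 (mem (shortest_paths G s t)) reg p0S.
have p1X : p1 \in min_paths Phi s t.
  rewrite in_set; apply/andP; split=> //.
  by apply/'forall_implyP => q; apply: p1M.
have [p2 p2S p2M] := @arg_minP _ _ _ p1 (mem (min_paths Phi s t)) img p1X.
rewrite /opt_min; case: pickP => [p|/(_ p2)/negbT/negP[]]; last first.
  by apply/andP; split=> //; apply/'forall_implyP => q; apply: p2M.
case/andP; rewrite !inE => /andP[/and3P[Gp /eqP lp _] _] _.
by exists p; rewrite ?size_tuple.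
Qed.

(** A gain has modulus 1, so its conjugate is its inverse, which is the gain of the reversed
    path. *)
Lemma geodesic_gain_herm (lt : rel 'I_n) g : connected G -> geodesic_gain g ->
  geodesic_gain (fun s t => if lt t s then conjc (g t s) else g s t).
Proof.
move=> Gc gg s t; case: ifP => _; last exact: gg.
have [p [Gp lp sp] ->] := gg t s.
exists (rev (belast t p)); last first.
  by rewrite conjc_path_gain // -path_gain_rev // lp.
split; first by rewrite -[X in path _ X]lp adj_rev_path.
- by rewrite -lp last_rev_belast.
- by rewrite size_rev size_belast sp dist_sym.
Qed.

Section GeodesicGain.
Variable g : 'I_n -> 'I_n -> R[i].
Hypotheses (Gc : connected G) (gg : geodesic_gain g).

Lemma geodesic_gain_norm s t : `|g s t| = 1.
Proof. by have [p [Gp _ _] ->] := gg s t; apply: path_gain_norm. Qed.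

Lemma geodesic_gain_adj s t : G s t -> g s t = gain Phi s t.
Proof.
move=> Gst; have [p [_]] := gg s t; rewrite dist_adj //.
by case: p => [|u []] //= -> _ ->; rewrite mulr1.
Qed.

End GeodesicGain.

End GainTheory.

(** * Hermitian matrices, Rayleigh quotients and diagonal similarity *)

Section HermitianSpectrum.
Variables (C : numClosedFieldType) (n : nat).
Implicit Types (A D : 'M[C]_n) (x y : 'rV[C]_n).
Local Open Scope sesquilinear_scope.

Lemma eigenvalue_spectralP D a : D \is normalmx ->
  reflect (exists k, a = spectral_diag D 0 k) (eigenvalue D a).
Proof.
move=> /orthomx_spectralP; set P := spectralmx D; set d := spectral_diag D.
have uP : P \in unitmx := spectral_unit D.
move=> DE; apply: (iffP eigenvalueP) => [[v vD vN0]|[k ->]].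
  pose w := v *m invmx P.
  have wd : w *m diag_mx d = a *: w.
    by rewrite /w scalemxAl -vD DE !mulmxA mulmxK.
  have wN0 : w != 0.
    by apply: contraNneq vN0 => w0; rewrite -[v](mulmxKV uP) -/w w0 mul0mx.
  clearbody w; have [k wk] := rV0Pn _ wN0; exists k; apply: (mulfI wk).
  move/rowP: wd => /(_ k); rewrite mul_mx_diag !mxE => ->.
  by rewrite mulrC.
exists (row k P).
  rewrite rowE DE !mulmxA mulmxK // -rowE -!rowE.
  by rewrite row_diag_mx -scalemxAl -rowE.
apply/eqP => rk0; have := oner_neq0 C.
have /matrixP/(_ k k) : P *m invmx P = 1%:M by rewrite mulmxV.
rewrite !mxE eqxx mulr1n => <-; rewrite big1 ?eqxx // => j _.
by move/rowP: rk0 => /(_ j); rewrite !mxE => ->; rewrite mul0r.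
Qed.

(** Let [w] be the coordinates of [y] in an orthonormal eigenbasis. The hypothesis says that the sum
    of the nonnegative terms [(l - d 0 k) * |w 0 k|^2] is at most 0, so each term vanishes. *)
Lemma rayleigh_max_eigenvector D (l : C) y :
    D \is hermsymmx -> (forall a, eigenvalue D a -> a <= l) ->
    l * (y *m y^t*) 0 0 <= (y *m D *m y^t*) 0 0 ->
  y *m D = l *: y.
Proof.
move=> /hermitian_normalmx Dn Dl.
have {}Dl k : spectral_diag D 0 k <= l.
  by apply: Dl; apply/eigenvalue_spectralP => //; exists k.
move: Dl (Dn) => + /orthomx_spectralP.
set P := spectralmx D; set d := spectral_diag D => Dl DE.
have uP : P \in unitmx := spectral_unit D.
have PtV : P^t* = invmx P by rewrite invmx_unitary ?spectral_unitarymx.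
have [w wE] : exists w, w = y *m invmx P by exists (y *m invmx P).
have yE : y = w *m P by rewrite wE mulmxKV.
have yD : y *m D = w *m diag_mx d *m P by rewrite DE wE !mulmxA.
have ytE : y^t* = invmx P *m w^t* by rewrite {1}yE trmx_mul map_mxM PtV.
rewrite ytE yD !mulmxA mulmxK // -wE mul_mx_diag.
rewrite !mxE mulr_sumr -subr_le0 -sumrB => le0.
have wk k : (l - d 0 k) * `|w 0 k| ^+ 2 = 0.
  have ge0 i : true -> 0 <= (l - d 0 i) * `|w 0 i| ^+ 2.
    by move=> _; rewrite mulr_ge0 ?subr_ge0 ?exprn_ge0.
  apply: (psumr_eq0P ge0) => //; apply/le_anti; rewrite sumr_ge0 // andbT.
  apply: le_trans le0; rewrite le_eqVlt; apply/orP; left; apply/eqP.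
  apply: eq_bigr => i _; rewrite !mxE normCK mulrBl; congr (_ - _).
  by rewrite mulrA [_ * d _ _]mulrC.
rewrite [in RHS]yE scalemxAl; congr (_ *m P); apply/rowP => k.
rewrite !mxE; have /eqP := wk k.
rewrite mulf_eq0 sqrf_eq0 normr_eq0 subr_eq0 => /orP[] /eqP ->.
  by rewrite mulrC.
by rewrite mulr0 mul0r.
Qed.

Lemma perron_equality A D (l : C) :
    D \is hermsymmx -> (forall i j, `|A i j| = D i j) ->
    (forall i j, i != j -> 0 < D i j) ->
    l \is Num.real ->
    (forall a, eigenvalue D a -> a <= l) -> eigenvalue A l ->
  exists2 theta : 'I_n -> C, forall i, theta i != 0 &
    forall i j, i != j -> A i j = D i j * (theta i / theta j).
Proof.
move=> Dh AD Dpos lR Dl /eigenvalueP[x xA xN0].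
pose y : 'rV[C]_n := \row_i `|x 0 i|.
have xAj j : \sum_i x 0 i * A i j = l * x 0 j.
  by move/rowP: xA => /(_ j); rewrite !mxE.
have normxA i j : `|x 0 i * A i j| = `|x 0 i| * D i j by rewrite normrM AD.
have yD : y *m D = l *: y.
  (* For each [j], [l * |x 0 j|] is at most [|l * x 0 j|], the modulus of the sum of the
     [x 0 i * A i j], hence at most the sum of the [|x 0 i| * D i j]. Weighting by [|x 0 j|] and
     summing gives the bound. *)
  apply: rayleigh_max_eigenvector => //.
  rewrite !mxE mulr_sumr; apply: ler_sum => j _; rewrite !mxE.
  rewrite mulrA; apply: ler_wpM2r; first by rewrite conjC_ge0.
  apply: le_trans (_ : `|l * x 0 j| <= _).
    by rewrite normrM ler_wpM2r // real_ler_norm.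
  rewrite -xAj; apply: le_trans (ler_norm_sum _ _ _) _.
  by apply: ler_sum => i _; rewrite normxA !mxE.
have {}yD j : \sum_i `|x 0 i| * D i j = l * `|x 0 j|.
  move/rowP: yD => /(_ j); rewrite !mxE => <-.
  by apply: eq_bigr => i _; rewrite mxE.
have Dge0 i j : 0 <= D i j by rewrite -AD.
have yge0 j i : true -> 0 <= `|x 0 i| * D i j by rewrite mulr_ge0.
(* If [x 0 j = 0], the nonnegative terms [|x 0 i| * D i j] sum to 0. Positivity off the diagonal
   then kills every entry of [x]. *)
have xj j : x 0 j != 0.
  apply: contraNneq xN0 => xj0; apply/eqP/rowP => i; rewrite mxE.
  have [->//|neq_ij] := eqVneq i j.
  have := yD j; rewrite xj0 normr0 mulr0.
  move=> /(psumr_eq0P (yge0 j))/(_ i isT)/eqP.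
  by rewrite mulf_eq0 normr_eq0 (gt_eqF (Dpos _ _ neq_ij)) orbF => /eqP.
exists (fun i => `|x 0 i| / x 0 i) => [i|i j neq_ij].
  by rewrite mulf_neq0 ?invr_eq0 ?normr_eq0.
(* The pair [i != j] matters here: for a zero matrix of size 1, [l] is 0. *)
have l_gt0 : 0 < l.
  have : 0 < l * `|x 0 j|.
    rewrite -yD (bigD1 i) //= ltr_wpDr ?sumr_ge0 // => [k _|].
      exact: yge0.
    by rewrite mulr_gt0 ?normr_gt0 ?Dpos.
  by rewrite pmulr_lgt0 ?normr_gt0.
have : `|\sum_k x 0 k * A k j| = \sum_k `|x 0 k * A k j|.
  rewrite xAj normrM gtr0_norm // -yD.
  by apply: eq_bigr => k _; rewrite normxA.
(* Equality in the triangle inequality gives all terms of column [j] a common phase [u]. Summing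
   them identifies [u] as the phase of [x 0 j]. *)
case/normC_sum_eq => u _ xu.
have xju : x 0 j = `|x 0 j| * u.
  apply: (mulfI (lt0r_neq0 l_gt0)); rewrite mulrA -yD -xAj mulr_suml.
  by apply: eq_bigr => k _; rewrite xu // normxA.
have nj : `|x 0 j| != 0 by rewrite normr_eq0.
have uE : u = x 0 j / `|x 0 j| by apply: (mulfI nj); rewrite -xju mulrC divfK.
apply: (mulfI (xj i)); rewrite (xu i) // normxA uE.
by field; rewrite nj !xj.
Qed.

(** With [T] the diagonal matrix of [theta], [A *m T = T *m D]. Hence the characteristic matrices
    satisfy the same relation over polynomials, and the nonzero determinant of [T'] cancels. *)
Lemma char_poly_diag_similar A D (theta : 'I_n -> C) :
    (forall i, theta i != 0) ->
    (forall i j, A i j = D i j * (theta i / theta j)) ->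
  char_poly A = char_poly D.
Proof.
move=> th0 AE; pose T := diag_mx (\row_i theta i).
have AT : A *m T = T *m D.
  apply/matrixP => i j; rewrite mul_mx_diag mul_diag_mx !mxE AE.
  by rewrite -mulrA divfK // mulrC.
pose T' := map_mx (@polyC C) T.
have detT : \det T' != 0.
  rewrite det_map_mx polyC_eq0 det_diag; apply/prodf_neq0 => i _.
  by rewrite mxE.
apply: (mulIf detT); rewrite -det_mulmx [RHS]mulrC -det_mulmx.
congr (\det _); rewrite /char_poly_mx mulmxBl mulmxBr -!map_mxM AT.
by rewrite scalar_mxC.
Qed.

End HermitianSpectrum.

(** * Comparison of gain distance matrices with the distance matrix *)

Section Comparison.
Variables (R : realType) (n : nat).
Implicit Types A B : 'M[R[i]]_n.

Lemma mem_spectrum A a : (a \in spectrum A) = eigenvalue A a.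
Proof.
rewrite eigenvalue_root_char /spectrum.
case: closed_field_poly_normal => /= r ->.
rewrite (monicP (char_poly_monic A)) scale1r.
by rewrite root_prod_XsubC.
Qed.

Lemma hermitian_largest_eigenvalue A :
  (0 < n)%N -> A \is hermsymmx -> exists l, largest_eigenvalue A l.
Proof.
move=> n_gt0 Ah; have An := hermitian_normalmx Ah.
have /mxOverP dR := hermitian_spectral_diag_real Ah.
pose re k := complex.Re (spectral_diag A 0 k).
have [k _ kM] := @arg_maxP _ _ _ (Ordinal n_gt0) xpredT re isT.
exists (re k); split.
  by apply/eigenvalue_spectralP => //; exists k; rewrite RRe_real.
move=> _ /(eigenvalue_spectralP _ An)[j ->].
by rewrite -(RRe_real (dR 0 j)) lecR; apply: kM.
Qed.

(** The two matrices have the same eigenvalues, and a largest one exists because [B] is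
    Hermitian. *)
Lemma same_spectrum_largest A B :
    (0 < n)%N -> B \is hermsymmx -> same_spectrum A B ->
  same_largest_eigenvalue A B.
Proof.
move=> n_gt0 Bh /perm_mem AB.
have eAB a : eigenvalue A a = eigenvalue B a by rewrite -!mem_spectrum AB.
have [l [Bl maxl]] := hermitian_largest_eigenvalue n_gt0 Bh.
by exists l; split; split=> [|x]; rewrite ?eAB //; apply: maxl.
Qed.

Lemma distmx_hermitian (G : sgraph n) :
  connected G -> distmx R G \is hermsymmx.
Proof.
move=> Gc; apply/is_hermitianmxP; rewrite expr0 scale1r.
by apply/matrixP => s t; rewrite !mxE conjC_nat dist_sym.
Qed.

Variables (Phi : gain_graph R n) (g : 'I_n -> 'I_n -> R[i]).
Local Notation G := (ugraph Phi).
Hypotheses (Gc : connected G) (gg : geodesic_gain Phi g).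

Let Dg : 'M[R[i]]_n := \matrix_(s, t) (g s t * (dist G s t)%:R).

Lemma balanced_same_spectrum :
  balanced Phi -> same_spectrum Dg (distmx R G).
Proof.
move=> /(balanced_potential Gc)[theta th0 thE].
rewrite /same_spectrum /spectrum.
rewrite (char_poly_diag_similar th0 (D := distmx R G)) // => s t.
rewrite !mxE mulrC; have [p [Gp <- _] ->] := gg s t.
by rewrite (path_gain_potential th0 thE).
Qed.

Lemma same_largest_eigenvalue_balanced :
  same_largest_eigenvalue Dg (distmx R G) -> balanced Phi.
Proof.
case=> l [[Al _] [_ Dl]].
have AD s t : `|Dg s t| = distmx R G s t.
  by rewrite !mxE normrM (geodesic_gain_norm gg) mul1r normr_nat.
have Dpos s t : s != t -> 0 < distmx R G s t.
  by move=> st; rewrite mxE ltr0n dist_gt0.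
have lR : (real_complex R l) \is Num.real by apply/complex_realP; exists l.
have [theta th0 thE] :=
  perron_equality (distmx_hermitian Gc) AD Dpos lR Dl Al.
apply: (potential_balanced th0) => u v Guv.
have neq_uv : u != v by apply: contraTneq Guv => ->; rewrite adj_irr.
have := thE u v neq_uv.
by rewrite !mxE dist_adj // mulr1 mul1r (geodesic_gain_adj Gc gg).
Qed.

End Comparison.

Theorem theorem5p4 (R : realType) (n : nat) (Phi : gain_graph R n)
    (lt : rel 'I_n) (hG : connected (ugraph Phi))
    (hlt : strict_total_order lt) :
  [<-> balanced Phi;
       same_spectrum (Dmax Phi lt) (distmx R (ugraph Phi));
       same_spectrum (Dmin Phi lt) (distmx R (ugraph Phi));
       same_largest_eigenvalue (Dmax Phi lt) (distmx R (ugraph Phi));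
       same_largest_eigenvalue (Dmin Phi lt) (distmx R (ugraph Phi))].
Proof.
have n_gt0 := hG.1; have Dh := distmx_hermitian R hG.
have gM : geodesic_gain Phi (gain_max Phi lt).
  exact/geodesic_gain_herm/opt_max_geodesic.
have gm : geodesic_gain Phi (gain_min Phi lt).
  exact/geodesic_gain_herm/opt_min_geodesic.
(* The implications are proved in a cycle; passing between [Dmax] and [Dmin] goes through
   balance. *)
tfae.
- exact: balanced_same_spectrum.
- move=> /(same_spectrum_largest n_gt0 Dh).
  move=> /(same_largest_eigenvalue_balanced hG gM).
  exact: balanced_same_spectrum.
- move=> /(same_spectrum_largest n_gt0 Dh).
  move=> /(same_largest_eigenvalue_balanced hG gm).
  by move=> /(balanced_same_spectrum hG gM); apply: same_spectrum_largest.
- move=> /(same_largest_eigenvalue_balanced hG gM).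
  move=> /(balanced_same_spectrum hG gm).
  exact: same_spectrum_largest.
- exact: same_largest_eigenvalue_balanced.
Qed.
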